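(* Let $n > 0$ and let $S \subseteq \mathbb{R}^n$ be a set definable by a first-order formula (with $n$ free variables ranging over $\mathbb{R}$) in the structure $\langle \mathbb{R}, \mathbb{Z}, +, \leq \rangle$. Then $S$ belongs to the class $F_\sigma \cap G_\delta$ of the natural (Euclidean) topology of $\mathbb{R}^n$, i.e. $S$ is both a countable union of closed sets and a countable intersection of open sets.
   Context: The structure $\langle \mathbb{R}, \mathbb{Z}, +, \leq \rangle$ has domain $\mathbb{R}$, a unary predicate $\mathbb{Z}$ for the integers (so quantifiers may range over $\mathbb{R}$ or over $\mathbb{Z}$), the ternary predicate $+$ interpreted as $x + y = z$, and the usual order $\leq$. The natural topology of $\mathbb{R}^n$ is the one induced by the Euclidean distance $d(\vec{x},\vec{y}) = (\sum_{i=1}^n (x_i-y_i)^2)^{1/2}$. $F_\sigma$ denotes the class of countable unions of closed sets and $G_\delta$ the class of countable intersections of open sets. *)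

(* Defs.v *)
From HB Require Import structures.
From mathcomp Require Import all_boot all_order all_algebra.
From mathcomp Require Import all_classical all_reals all_analysis.

Set Implicit Arguments.
Unset Strict Implicit.
Unset Printing Implicit Defensive.

Import Order.TTheory GRing.Theory Num.Theory.
Import numFieldNormedType.Exports.

Local Open Scope classical_set_scope.
Local Open Scope ring_scope.

(* First-order formulas over the relational language {Z, +, <=} with equality.
   [formula n] is the type of formulas whose free variables are among n
   variables. A quantifier binds variable 0 of its body, variable i.+1 of the
   body being variable i outside. Quantifiers range over the reals; those over
   the integers are their relativizations to the predicate [FInt]. *)
Inductive formula : nat -> Type :=
| FEq n : 'I_n -> 'I_n -> formula n
| FInt n : 'I_n -> formula n
| FAdd n : 'I_n -> 'I_n -> 'I_n -> formula n
| FLe n : 'I_n -> 'I_n -> formula n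
| FNot n : formula n -> formula n
| FAnd n : formula n -> formula n -> formula n
| FOr n : formula n -> formula n -> formula n
| FImp n : formula n -> formula n -> formula n
| FEx n : formula n.+1 -> formula n
| FAll n : formula n.+1 -> formula n.

Definition env_cons (T : Type) (n : nat) (x : T) (v : 'I_n -> T) :
    'I_n.+1 -> T :=
  fun i => if unlift ord0 i is Some j then v j else x.

Fixpoint holds (R : realType) (n : nat) (f : formula n) : ('I_n -> R) -> Prop :=
  match f in formula m return ('I_m -> R) -> Prop with
  | FEq _ i j => fun v => v i = v j
  | FInt _ i => fun v => v i \is a Num.int
  | FAdd _ i j k => fun v => v i + v j = v k
  | FLe _ i j => fun v => v i <= v j
  | FNot _ g => fun v => ~ holds g v
  | FAnd _ g h => fun v => holds g v /\ holds h v
  | FOr _ g h => fun v => holds g v \/ holds h v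
  | FImp _ g h => fun v => holds g v -> holds h v
  | FEx _ g => fun v => exists x : R, holds g (env_cons x v)
  | FAll _ g => fun v => forall x : R, holds g (env_cons x v)
  end.

Definition definable (R : realType) (n : nat) (S : set 'rV[R]_n) : Prop :=
  exists f : formula n, S = [set x : 'rV[R]_n | holds f (fun i => x ord0 i)].

Definition euclidean_dist (R : realType) (n : nat) (x y : 'rV[R]_n) : R :=
  Num.sqrt (\sum_(i < n) (x ord0 i - y ord0 i) ^+ 2).

(* The library's topology on row vectors is the product topology; this lemma
   identifies it with the one induced by the Euclidean distance. *)
Lemma open_euclideanP (R : realType) (n : nat) (A : set 'rV[R]_n) :
  open A <->
  forall x, A x ->
    exists2 e : R, 0 < e & forall y, euclidean_dist x y < e -> A y.
Proof.
split=> [oA x Ax|H].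
  have /nbhs_ballP[e /= e0 eA] : nbhs x A by exact: open_nbhs_nbhs.
  exists e => // y xy; apply: eA; split=> // i j.
  rewrite (ord1 i) /ball /=; apply: le_lt_trans xy.
  rewrite -sqrtr_sqr ler_wsqrtr// (bigD1 j)//= lerDl.
  by apply: sumr_ge0 => k _; exact: sqr_ge0.
rewrite openE => x Ax; have [e e0 eA] := H _ Ax.
pose d : R := e / n.+1%:R.
have d0 : 0 < d by rewrite divr_gt0.
apply/nbhs_ballP; exists d => //= y [_ xy]; apply: eA.
have -> : e = Num.sqrt (e ^+ 2) by rewrite sqrtr_sqr gtr0_norm.
rewrite /euclidean_dist ltr_sqrt ?exprn_gt0//.
have le : \sum_(i < n) (x ord0 i - y ord0 i) ^+ 2 <= \sum_(i < n) d ^+ 2.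
  apply: ler_sum => i _; rewrite -real_normK ?num_real//.
  by rewrite ler_sqr ?nnegrE ?normr_ge0 ?(ltW d0)//; exact/ltW/xy.
apply: (le_lt_trans le); rewrite sumr_const card_ord -mulr_natl.
have -> : e ^+ 2 = n.+1%:R ^+ 2 * d ^+ 2.
  by rewrite -exprMn mulrC /d divfK.
rewrite ltr_pM2r ?exprn_gt0// -natrX ltr_nat.
by apply: (@leq_trans n.+1) => //; rewrite expnS leq_pmulr// expn_gt0.
Qed.

(* Main.v *)
(* Write a real as the sum of its integer part and of a fractional part in
   [0, 1). Over a slice, i.e. for fixed integer parts of all coordinates, an
   atomic formula becomes a linear condition on the fractional parts, and the
   integer parts contribute only finitely many constants to it. Hence, as the
   slice varies, an atomic formula cuts out members of a finite family of
   semilinear sets. This property is stable under Boolean operations, and under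
   projection by Fourier-Motzkin elimination; no quantifier elimination for the
   integers is needed, because the dependence on the slice is left arbitrary.
   A definable set is thus a countable union of translated semilinear sets,
   hence an F_sigma; so is its complement. *)

Require Import Defs.
From mathcomp Require Import all_boot all_order all_algebra ring lra zify.
From mathcomp Require Import all_classical all_reals all_analysis borel_hierarchy.

Import Order.TTheory GRing.Theory Num.Theory.
Import numFieldNormedType.Exports.

Local Open Scope classical_set_scope.
Local Open Scope ring_scope.

Set Implicit Arguments.
Unset Strict Implicit.
Unset Printing Implicit Defensive.

(** * Semilinear sets and their Boolean operations *)

Section Semilinear.
Variable R : realType.

Definition affine n := (('I_n -> R) * R)%type.

Definition aff n (l : affine n) (v : 'I_n -> R) : R :=
  l.2 + \sum_i l.1 i * v i.

Definition lincomb n (a : R) (l : affine n) (b : R) (m : affine n) : affine n :=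
  (fun i => a * l.1 i + b * m.1 i, a * l.2 + b * m.2).

Lemma aff_lincomb n a (l : affine n) b m v :
  aff (lincomb a l b m) v = a * aff l v + b * aff m v.
Proof.
rewrite /aff !mulrDr !mulr_sumr addrACA -big_split /=; congr (_ + _).
by apply: eq_bigr => i _; rewrite mulrDl !mulrA.
Qed.

(* The flag of a constraint tells whether its inequality is non-strict. *)
Definition constraint n := (affine n * bool)%type.

Definition sat n (v : 'I_n -> R) (c : constraint n) : bool :=
  0 < aff c.1 v ?<= if c.2.

(** Disjunctive normal form: the outer list is a disjunction of conjunctions, that is, a finite
    union of polyhedra with some faces removed. *)
Definition semilinear n (A : set ('I_n -> R)) : Prop :=
  exists ss : seq (seq (constraint n)), A = [set v | has (all (sat v)) ss].

Lemma semilinear_constraint n (c : constraint n) :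
  semilinear [set v | sat v c].
Proof. by exists [:: [:: c]]; apply/seteqP; split=> v /=; rewrite orbF andbT. Qed.

Lemma semilinear0 n : semilinear (@set0 ('I_n -> R)).
Proof. by exists [::]; apply/seteqP; split. Qed.

Lemma semilinearT n : semilinear [set: 'I_n -> R].
Proof. by exists [:: [::]]; apply/seteqP; split. Qed.

Lemma semilinearU n (A B : set ('I_n -> R)) :
  semilinear A -> semilinear B -> semilinear (A `|` B).
Proof.
move=> [ss ->] [tt ->]; exists (ss ++ tt).
by apply/seteqP; split=> v /=; rewrite has_cat => /orP.
Qed.

Lemma semilinearI n (A B : set ('I_n -> R)) :
  semilinear A -> semilinear B -> semilinear (A `&` B).
Proof.
move=> [ss ->] [tt ->]; exists [seq s ++ t | s <- ss, t <- tt].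
apply/seteqP; split=> v /=.
  move=> [/hasP[s s_in sv] /hasP[t t_in tv]]; apply/hasP; exists (s ++ t).
    exact: allpairs_f.
  by rewrite all_cat sv.
move=> /hasP[_ /allpairsP[[s t] /= [s_in t_in ->]]].
by rewrite all_cat => /andP[sv tv]; split; apply/hasP; [exists s|exists t].
Qed.

Lemma sat_neg n (v : 'I_n -> R) (c : constraint n) :
  sat v (lincomb (-1) c.1 0 c.1, ~~ c.2) = ~~ sat v c.
Proof.
rewrite /sat aff_lincomb /= mul0r addr0 mulN1r -lteifNE.
by case: (c.2) => /=; rewrite (oppr_gt0, oppr_ge0).
Qed.

(** By De Morgan, each conjunction becomes a disjunction of single negated constraints, and
    [sat_neg] turns each of these back into a constraint. *)
Lemma semilinearC n (A : set ('I_n -> R)) : semilinear A -> semilinear (~` A).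
Proof.
move=> [ss ->]; elim: ss => [|s ss IH].
  rewrite (_ : ~` _ = setT); first exact: semilinearT.
  by apply/seteqP; split=> v.
rewrite (_ : ~` _ = ~` [set v | all (sat v) s] `&`
                    ~` [set v | has (all (sat v)) ss]); last first.
  by rewrite -setCU; congr (~` _); apply/seteqP; split=> v /= /orP.
apply: semilinearI => //.
exists [seq [:: (lincomb (-1) c.1 0 c.1, ~~ c.2)] | c <- s].
apply/seteqP; split=> v /=; rewrite has_map.
  move=> /negP; rewrite -has_predC => /hasP[c cs cv]; apply/hasP; exists c => //=.
  by rewrite sat_neg andbT.
move=> /hasP[c cs /=]; rewrite sat_neg andbT => cv; apply/negP.
by rewrite -has_predC; apply/hasP; exists c.
Qed.

Lemma semilinear_bigcup n (I : finType) (A : I -> set ('I_n -> R))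
    (D : {set I}) :
  (forall i, semilinear (A i)) -> semilinear (\bigcup_(i in [set` D]) A i).
Proof.
move=> sA; rewrite (_ : [set` D] = [set` enum D]); last first.
  by apply/seteqP; split=> i /=; rewrite mem_enum.
rewrite bigcup_seq; elim/big_ind: _ => [|B C|i _]; last exact: sA.
  exact: semilinear0.
exact: semilinearU.
Qed.

(** * Fourier-Motzkin elimination *)

(* The largest lower bound and the smallest upper bound
   are compared as interval bounds, so that strictness is taken into account. *)
Lemma between_bounds (L U : seq (R * bool)) :
  (forall l u, l \in L -> u \in U -> l.1 < u.1 ?<= if l.2 && u.2) ->
  exists x, (forall l, l \in L -> l.1 < x ?<= if l.2) /\
            (forall u, u \in U -> x < u.1 ?<= if u.2).
Proof.
move=> LU.
pose lo (l : R * bool) := BSide l.2 l.1; pose up (u : R * bool) := BSide (~~ u.2) u.1.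
pose a := (\big[Order.max/-oo]_(l <- L) lo l)%O.
pose b := (\big[Order.min/+oo]_(u <- U) up u)%O.
have ab : (a < b)%O.
  rewrite /a big_seq; apply: bigmax_lt => [|l lL]; rewrite /b big_seq;
    apply: lt_bigmin => // u uU.
  by rewrite /lo /up ltBSide negbK LU.
suff [x ax xb] : exists2 x : R, (a <= BLeft x)%O & (BRight x <= b)%O.
  exists x; split=> [l lL|u uU].
    have : (lo l <= BLeft x)%O by apply: le_trans ax; exact: le_bigmax_seq.
    by rewrite /lo leBSide.
  have : (BRight x <= up u)%O by apply: (le_trans xb); exact: ge_bigmin_seq.
  by rewrite /up leBSide; case: (u.2).
(* The witness is the midpoint of two finite bounds, a unit shift of the only finite one, or 0 if
   there is none. *)
case: a b ab => [s y|[]] [t z|[]] //.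
- rewrite ltBSide => yz; exists ((y + z) / 2); rewrite leBSide;
    by case: s t yz => [] [] /= yz; lra.
- by move=> _; exists (y + 1); rewrite // leBSide; case: s => /=; lra.
- by move=> _; exists (z - 1); rewrite // leBSide; case: t => /=; lra.
- by move=> _; exists 0.
Qed.


Lemma env_cons0 n x (v : 'I_n -> R) : env_cons x v ord0 = x.
Proof. by rewrite /env_cons unlift_none. Qed.

Lemma env_consS n x (v : 'I_n -> R) i : env_cons x v (lift ord0 i) = v i.
Proof. by rewrite /env_cons liftK. Qed.

Definition lead n (c : constraint n.+1) : R := c.1.1 ord0.

Definition rest n (c : constraint n.+1) : affine n :=
  (fun i => c.1.1 (lift ord0 i), c.1.2).

Lemma aff_env_cons n (c : constraint n.+1) x v :
  aff c.1 (env_cons x v) = aff (rest c) v + lead c * x.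
Proof.
rewrite /aff big_ord_recl env_cons0 [X in _ + X = _]addrC addrA.
congr (_ + _ + _).
by apply: eq_bigr => i _; rewrite env_consS.
Qed.

(** The value of variable 0 at which the affine form vanishes; meaningful only when [lead c] is
    non-zero. *)
Definition root n (v : 'I_n -> R) (c : constraint n.+1) : R :=
  - aff (rest c) v / lead c.

Lemma sat_lower n (c : constraint n.+1) x v : 0 < lead c ->
  sat (env_cons x v) c = (root v c < x ?<= if c.2).
Proof.
move=> c0; rewrite /sat aff_env_cons /root lteif_pdivrMr//.
by rewrite -[RHS]subr_lteif0r opprK addrC mulrC.
Qed.

Lemma sat_upper n (c : constraint n.+1) x v : lead c < 0 ->
  sat (env_cons x v) c = (x < root v c ?<= if c.2).
Proof.
move=> c0; rewrite /sat aff_env_cons /root lteif_ndivlMr//.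
by rewrite -[RHS]subr_lteif0r opprK addrC mulrC.
Qed.

(** For a lower bound [c] and an upper bound [d], both weights are positive and variable 0 cancels.
    Clearing the denominators of the two roots keeps the comparison affine in [v]. *)
Definition cross n (c d : constraint n.+1) : constraint n :=
  (lincomb (lead c) (rest d) (- lead d) (rest c), c.2 && d.2).

Lemma sat_cross n (c d : constraint n.+1) v : 0 < lead c -> lead d < 0 ->
  sat v (cross c d) = (root v c < root v d ?<= if c.2 && d.2).
Proof.
move=> c0 d0; rewrite /sat /root aff_lincomb lteif_pdivrMr// mulrAC.
rewrite lteif_ndivlMr// -[RHS]subr_lteif0r; congr (Order.lteif _ _ _); ring.
Qed.

Definition eliminate n (s : seq (constraint n.+1)) : seq (constraint n) :=
  [seq (rest c, c.2) | c <- s & lead c == 0] ++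
  [seq cross c d | c <- [seq c <- s | 0 < lead c],
                   d <- [seq d <- s | lead d < 0]].

(** Constraints with zero leading coefficient ignore [x]; the others bound [x] by their roots.
    Compatible bounds leave room for some [x] by [between_bounds]; conversely, any such [x] compares
    them by transitivity. *)
Lemma eliminateP n (s : seq (constraint n.+1)) v :
  all (sat v) (eliminate s) <-> exists x, all (sat (env_cons x v)) s.
Proof.
have sat0 (c : constraint n.+1) x : lead c = 0 ->
    sat (env_cons x v) c = sat v (rest c, c.2).
  by move=> c0; rewrite /sat aff_env_cons c0 mul0r addr0.
split=> [/allP sv|[x /allP sx]].
  pose bd (c : constraint n.+1) := (root v c, c.2).
  have [|x [xL xU]] := @between_bounds [seq bd c | c <- s & 0 < lead c]
                                        [seq bd c | c <- s & lead c < 0].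
    move=> _ _ /mapP[c + ->] /mapP[d + ->].
    rewrite !mem_filter => /andP[c0 cs] /andP[d0 ds] /=.
    rewrite -sat_cross//; apply: sv; rewrite mem_cat; apply/orP; right.
    by apply: allpairs_f; rewrite mem_filter ?c0 ?d0.
  exists x; apply/allP => c cs; have [c0|c0|c0] := ltgtP (lead c) 0.
  - by rewrite sat_upper//; apply: (xU (bd c)); rewrite map_f// mem_filter c0.
  - by rewrite sat_lower//; apply: (xL (bd c)); rewrite map_f// mem_filter c0.
  - rewrite sat0//; apply: sv; rewrite mem_cat; apply/orP; left.
    by apply/mapP; exists c => //; rewrite mem_filter c0 eqxx.
apply/allP => e; rewrite mem_cat => /orP[/mapP[c + ->]|/allpairsP[[c d] /= []]].
  by rewrite mem_filter => /andP[/eqP c0 cs]; rewrite -(sat0 _ x)// sx.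
rewrite !mem_filter => /andP[c0 cs] /andP[d0 ds] ->; rewrite sat_cross//.
by apply: (@lteif_trans _ _ _ x); rewrite -?sat_lower -?sat_upper ?sx.
Qed.

Lemma semilinear_proj n (A : set ('I_n.+1 -> R)) : semilinear A ->
  semilinear [set v : 'I_n -> R | exists x, A (env_cons x v)].
Proof.
move=> [ss ->]; exists (map (@eliminate n) ss); apply/seteqP; split=> v /=.
  move=> [x /hasP[s ss_s sx]]; apply/hasP; exists (eliminate s).
    exact: map_f.
  by apply/eliminateP; exists x.
move=> /hasP[_ /mapP[s ss_s ->] /eliminateP[x sx]]; exists x.
by apply/hasP; exists s.
Qed.


(** * Slicewise semilinear sets: Boolean operations and projection *)

Definition unit_cube n : set ('I_n -> R) := [set f | forall i, 0 <= f i < 1].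

(** The sets [A i] are arbitrary outside the cube, so that complements can be taken without cutting
    back to it. *)
Definition slicewise_semilinear n (S : set ('I_n -> R)) : Prop :=
  exists (I : finType) (A : I -> set ('I_n -> R)),
    (forall i, semilinear (A i)) /\
    forall z : 'I_n -> int, exists i, forall f, unit_cube f ->
      S (fun j => (z j)%:~R + f j) <-> A i f.

Lemma slicewise_semilinearC n (S : set ('I_n -> R)) :
  slicewise_semilinear S -> slicewise_semilinear (~` S).
Proof.
move=> [I [A [sA SA]]]; exists I, (fun i => ~` A i).
split=> [i|z]; first exact/semilinearC.
by have [i Ai] := SA z; exists i => f f01; apply: not_iff_compat; exact: Ai.
Qed.

Lemma slicewise_semilinearI n (S T : set ('I_n -> R)) :
  slicewise_semilinear S -> slicewise_semilinear T ->
  slicewise_semilinear (S `&` T).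
Proof.
move=> [I [A [sA SA]]] [J [B [sB TB]]].
exists (I * J)%type, (fun k => A k.1 `&` B k.2).
split=> [k|z]; first exact: semilinearI.
have [[i Ai] [j Bj]] := (SA z, TB z); exists (i, j) => f f01 /=.
by split=> -[/(Ai f f01) ? /(Bj f f01)].
Qed.

Lemma slicewise_semilinearU n (S T : set ('I_n -> R)) :
  slicewise_semilinear S -> slicewise_semilinear T ->
  slicewise_semilinear (S `|` T).
Proof.
move=> sS sT; rewrite -[_ `|` _]setCK setCU.
by apply/slicewise_semilinearC/slicewise_semilinearI;
  exact: slicewise_semilinearC.
Qed.

Definition coord n (j : 'I_n) : affine n := (fun i => (i == j)%:R, 0).

Lemma aff_coord n (j : 'I_n) v : aff (coord j) v = v j.
Proof.
rewrite /aff add0r (bigD1 j)//= eqxx mul1r big1 ?addr0// => i /negbTE ->.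
by rewrite mul0r.
Qed.

Lemma semilinear_itv01 n (j : 'I_n) :
  semilinear [set v : 'I_n -> R | 0 <= v j < 1].
Proof.
(* The pair [(fun=> 0, 1)] is the constant form 1, so the removed constraint says that [v j - 1] is
   non-negative. *)
rewrite (_ : mkset _ = [set v | sat v (coord j, true)] `\`
    [set v | sat v (lincomb 1 (coord j) (-1) (fun=> 0, 1), true)]).
  by rewrite setDE; apply: semilinearI; last apply: semilinearC;
    exact: semilinear_constraint.
apply/seteqP; split=> v /=; rewrite /sat aff_lincomb aff_coord /=;
  rewrite (_ : aff (_, _) _ = 1) ?mulN1r ?mul1r ?subr_ge0 ?leNgt.
- by move=> /andP[-> ->].
- by rewrite /aff big1 ?addr0// => i _; rewrite mul0r.
- by move=> [-> /negP]; rewrite negbK => ->.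
- by rewrite /aff big1 ?addr0// => i _; rewrite mul0r.
Qed.

Lemma semilinear_unit_cube n : semilinear (@unit_cube n).
Proof.
rewrite (_ : @unit_cube n = ~` \bigcup_(i in [set` [set: 'I_n]%SET])
    ~` [set v | 0 <= v i < 1]).
  by apply/semilinearC/semilinear_bigcup => i; exact/semilinearC/semilinear_itv01.
rewrite setC_bigcup; apply/seteqP; split=> v v01 i => [_|].
  by move=> /(_ (v01 i)).
by apply: contrapT; apply: v01; rewrite /= inE.
Qed.

Lemma env_cons_int_frac n k g (z : 'I_n -> int) (f : 'I_n -> R) :
  env_cons (k%:~R + g) (fun j => (z j)%:~R + f j) =
  (fun j => (env_cons k z j)%:~R + env_cons g f j).
Proof. by apply/funext => j; rewrite /env_cons; case: unlift. Qed.

Lemma unit_cube_env_cons n g (f : 'I_n -> R) :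
  unit_cube (env_cons g f) <-> 0 <= g < 1 /\ unit_cube f.
Proof.
split=> [gf|[g01 f01] i]; last by rewrite /env_cons; case: unlift.
split=> [|i]; first by have := gf ord0; rewrite env_cons0.
by have := gf (lift ord0 i); rewrite env_consS.
Qed.

(* Over a fixed slice the projection is a union, indexed by the integer part
   of the eliminated variable, of projections taken from a finite family: only
   finitely many unions can occur. *)
Lemma slicewise_semilinear_proj n (S : set ('I_n.+1 -> R)) :
  slicewise_semilinear S ->
  slicewise_semilinear [set v : 'I_n -> R | exists x, S (env_cons x v)].
Proof.
move=> [I [A [sA SA]]].
pose B i := [set f : 'I_n -> R | exists g : R,
  (A i `&` [set h | 0 <= h ord0 < 1]) (env_cons g f)].
exists {set I}, (fun D : {set I} => \bigcup_(i in [set` D]) B i).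
split=> [D|z].
  apply: semilinear_bigcup => i; apply: semilinear_proj; apply: semilinearI => //.
  exact: semilinear_itv01.
pose fits k i := forall h, unit_cube h ->
  S (fun j => (env_cons k z j)%:~R + h j) <-> A i h.
(* Collect every index that describes the slice over [z] for at least one integer part [k] of
   variable 0. *)
exists [set i | `[< exists k, fits k i >]]%SET => f f01.
split=> [[x Sx]|[i /=]].
  have [i Ai] := SA (env_cons (Num.floor x) z).
  have x01 : 0 <= x - (Num.floor x)%:~R < 1.
    by have := floor_itv x; rewrite intrD; lra.
  exists i; first by rewrite /= inE; apply/asboolP; exists (Num.floor x).
  exists (x - (Num.floor x)%:~R); split; last by rewrite /= env_cons0.
  by apply/Ai; [apply/unit_cube_env_cons|rewrite -env_cons_int_frac addrC subrK].
rewrite inE => /asboolP[k Ai] [g [Ag /=]]; rewrite env_cons0 => g01.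
exists (k%:~R + g); rewrite env_cons_int_frac; apply/Ai => //.
exact/unit_cube_env_cons.
Qed.

(** * Atomic formulas *)

(** On a slice the form is [N + s], where the integer [N] comes from the integer parts and
    [|s| <= M] on the cube. Clamping [N] to a bounded range preserves the sign condition and leaves
    finitely many constants. *)
Lemma slicewise_semilinear_ge0 n (a : 'I_n -> int) :
  slicewise_semilinear [set v | 0 <= \sum_i (a i)%:~R * v i].
Proof.
pose M := (\sum_i `|a i|)%N.
have M_bound (f : 'I_n -> R) : unit_cube f ->
    `|\sum_i (a i)%:~R * f i| <= M%:~R.
  move=> f01; rewrite (le_trans (ler_norm_sum _ _ _))//.
  rewrite /M -pmulrn natr_sum ler_sum// => i _; have /andP[f0 f1] := f01 i.
  by rewrite normrM (ger0_norm f0) -intr_norm natr_absz ler_piMr// ltW.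
(* Index [k] codes the constant [k - (M + 1)], so the constants run from [-M-1] to [M]. The range is
   asymmetric because the bound on [s] does not exclude [-M + s = 0], which satisfies the
   inequality. *)
exists 'I_(M + M).+2, (fun k : 'I_(M + M).+2 => [set v |
  sat v ((fun i => (a i)%:~R, ((k : nat)%:Z - M.+1%:Z)%:~R), true)]).
split=> [k|z]; first exact: semilinear_constraint.
(* Beyond [-M-1, M] the integer part alone decides the sign. *)
pose N : int := \sum_i a i * z i.
pose c : int := Num.max (- M.+1%:Z) (Num.min N M%:Z).
have c_ge : - M.+1%:Z <= c by rewrite le_max lexx.
have c_le : c <= M%:Z by rewrite ge_max ge_min lexx orbT andbT; lia.
have k_lt : (`|(c + M.+1%:Z)%R| < (M + M).+2)%N by lia.
exists (Ordinal k_lt) => f /M_bound sM.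
rewrite /= /sat /aff /= gez0_abs ?addrK; last by lia.
have -> : \sum_i (a i)%:~R * ((z i)%:~R + f i) =
    N%:~R + \sum_i (a i)%:~R * f i.
  rewrite rmorph_sum -big_split; apply: eq_bigr => i _ /=.
  by rewrite mulrDr rmorphM.
move: sM; rewrite ler_norml; set s := \sum_i _ => /andP[s_ge s_le].
have [NM|NM] := leP N M%:Z; last first.
  have -> : c = M%:Z by rewrite /c; lia.
  by move: NM; rewrite -(ltr_int R) => NM; split=> _; lra.
have [MN|MN] := leP (- M.+1%:Z) N.
  by have -> : c = N by rewrite /c; lia.
have -> : c = - M.+1%:Z by rewrite /c; lia.
move: MN; rewrite -(ltr_int R) -addn1 PoszD opprD !rmorphD !rmorphN/= => MN.
by split; lra.
Qed.


Lemma sum_delta n (j : 'I_n) (v : 'I_n -> R) :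
  \sum_i (i == j)%:~R * v i = v j.
Proof. by have := aff_coord j v; rewrite /aff add0r. Qed.

Lemma slicewise_semilinear_le n (i j : 'I_n) :
  slicewise_semilinear [set v | v i <= v j].
Proof.
(* A difference of Kronecker deltas also covers the case [i = j]. *)
pose a l : int := (l == j)%:Z - (l == i)%:Z.
have aE (v : 'I_n -> R) : \sum_l (a l)%:~R * v l = v j - v i.
  rewrite -(sum_delta j) -(sum_delta i) -sumrB; apply: eq_bigr => l _.
  by rewrite /a rmorphB mulrBl.
rewrite (_ : mkset _ = [set v | 0 <= \sum_l (a l)%:~R * v l]).
  exact: slicewise_semilinear_ge0.
by apply/funext => v; rewrite /mkset aE subr_ge0.
Qed.

Lemma slicewise_semilinear_add n (i j k : 'I_n) :
  slicewise_semilinear [set v | v i + v j = v k].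
Proof.
pose a l : int := (l == i)%:Z + (l == j)%:Z - (l == k)%:Z.
have aE (v : 'I_n -> R) : \sum_l (a l)%:~R * v l = v i + v j - v k.
  rewrite -(sum_delta i) -(sum_delta j) -(sum_delta k) -big_split -sumrB.
  by apply: eq_bigr => l _; rewrite /a rmorphB rmorphD mulrBl mulrDl.
have NaE (v : 'I_n -> R) : \sum_l (- a l)%:~R * v l = v k - (v i + v j).
  by rewrite -opprB -aE -sumrN; apply: eq_bigr => l _; rewrite rmorphN mulNr.
rewrite (_ : mkset _ = [set v | 0 <= \sum_l (a l)%:~R * v l] `&`
                       [set v | 0 <= \sum_l (- a l)%:~R * v l]).
  by apply: slicewise_semilinearI; exact: slicewise_semilinear_ge0.
apply/funext => v; apply/propext; rewrite /setI /mkset aE NaE !subr_ge0.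
by split=> [->|[? ?]]; [|apply/eqP; rewrite eq_le; apply/andP].
Qed.

(** Integrality depends only on the fractional part, which must be 0; on the cube this means not
    positive, so one set serves all slices. *)
Lemma slicewise_semilinear_int n (i : 'I_n) :
  slicewise_semilinear [set v : 'I_n -> R | v i \is a Num.int].
Proof.
exists unit, (fun=> ~` [set v | sat v (coord i, false)]).
split=> [_|z]; first exact/semilinearC/semilinear_constraint.
exists tt => f /(_ i) f01 /=; rewrite rpredDl ?intr_int// /sat aff_coord /=.
split=> [/intrP[m fm]|/negP].
  by move: f01; rewrite fm ler0z ltrz1 ltr0z => ?; apply/negP; lia.
by rewrite -leNgt => f0; rewrite (_ : f i = 0) ?rpred0//; lra.
Qed.

Lemma slicewise_semilinear_holds n (f : formula n) :
  slicewise_semilinear (holds f : set ('I_n -> R)).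
Proof.
elim: f => {}n.
- move=> i j; rewrite (_ : holds _ = [set v | v i <= v j] `&`
                                   [set v | v j <= v i]).
    by apply: slicewise_semilinearI; exact: slicewise_semilinear_le.
  apply/funext => v; apply/propext => /=.
  by split=> [->|[? ?]]; [|apply/eqP; rewrite eq_le; apply/andP].
- exact: slicewise_semilinear_int.
- exact: slicewise_semilinear_add.
- exact: slicewise_semilinear_le.
- by move=> f; exact: slicewise_semilinearC.
- by move=> f sf g; exact: slicewise_semilinearI.
- by move=> f sf g; exact: slicewise_semilinearU.
- move=> f sf g sg; rewrite (_ : holds _ = ~` holds f `|` holds g).
    by apply: slicewise_semilinearU => //; exact: slicewise_semilinearC.
  by apply/funext => v; exact: implyE.
- by move=> f; exact: slicewise_semilinear_proj.
- move=> f sf; rewrite (_ : holds _ =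
      ~` [set v | exists x, (~` holds f) (env_cons x v)]).
    exact/slicewise_semilinearC/slicewise_semilinear_proj/slicewise_semilinearC.
  by apply/funext => v; apply/propext; split=> /= [fv [x nf]|/forallNP fv x];
    [exact: nf (fv x)|exact: contrapT (fv x)].
Qed.

End Semilinear.

(** * Passage to the Borel class *)

Lemma Fsigma_bigcup (T : topologicalType) (I : countType) (D : set I)
    (F : I -> set T) :
  (forall i, Fsigma (F i)) -> Fsigma (\bigcup_(i in D) F i).
Proof.
move=> /(_ _)/cid2-/all_sig2[G clG FG].
(* Enumerate the pairs [(i, k)] by their codes; numbers that code no pair, and indices outside [D],
   contribute the empty closed set. *)
exists (fun m => if unpickle m is Some (i, k) then
                   if `[< D i >] then G i k else set0 else set0).
  move=> m; case: unpickle => [[i k]|]; last exact: closed0.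
  by case: ifP => _; [exact: clG|exact: closed0].
apply/seteqP; split=> [x [i Di]|x [m _]].
  rewrite FG => -[k _ Gx]; exists (pickle (i, k)) => //.
  by rewrite pickleK asboolT.
case: unpickle => [[i k]|//]; case: asboolP => // Di Gx.
by exists i => //; rewrite FG; exists k.
Qed.

Lemma FsigmaI (T : topologicalType) (A B : set T) :
  Fsigma A -> Fsigma B -> Fsigma (A `&` B).
Proof.
move=> [F clF ->] [G clG ->].
rewrite (_ : _ `&` _ = \bigcup_(k in [set: nat * nat]) (F k.1 `&` G k.2)).
  by apply: Fsigma_bigcup => k; apply: closed_Fsigma; exact: closedI.
apply/seteqP; split=> x [].
  by move=> [i _ Fx] [j _ Gx]; exists (i, j).
by move=> [i j] _ [Fx Gx]; split; [exists i|exists j].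
Qed.

(** A strict inequality is the union over [k] of the closed conditions [1 / (k + 1) <= h x]. *)
Lemma Fsigma_preimage_lteif (R : realType) (T : topologicalType) (h : T -> R)
    (b : bool) :
  continuous h -> Fsigma [set x | 0 < h x ?<= if b].
Proof.
move=> ch; have cl e : closed (h @^-1` [set y | e <= y]).
  by have /continuous_closedP := ch; apply; exact: closed_ge.
case: b => /=; first exact/closed_Fsigma/cl.
exists (fun k => h @^-1` [set y | k.+1%:R^-1 <= y]) => //.
apply/seteqP; split=> [x /= hx|x [k _ /=]]; last exact: lt_le_trans.
have [k _ /(_ k (leqnn k)) kx] := near_infty_natSinv_lt (PosNum hx).
by exists k => //; exact: ltW.
Qed.

Lemma continuous_aff (R : realType) n (l : affine R n) (z : 'I_n -> R) :
  continuous (fun x : 'rV[R]_n => aff l (fun i => x ord0 i - z i)).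
Proof.
move=> x; rewrite /aff; apply: continuousD; first exact: cst_continuous.
elim: (index_enum _) => [|i r IH].
  rewrite (_ : (fun _ => _) = cst 0); first exact: cst_continuous.
  by apply/funext => y; rewrite big_nil.
rewrite (_ : (fun _ => _) = fun y : 'rV[R]_n => l.1 i * (y ord0 i - z i) +
    \sum_(j <- r) l.1 j * (y ord0 j - z j)); last first.
  by apply/funext => y; rewrite big_cons.
apply: continuousD => //; apply: continuousM; first exact: cst_continuous.
by apply: continuousB; [exact: coord_continuous|exact: cst_continuous].
Qed.

Lemma Fsigma_semilinear (R : realType) n (A : set ('I_n -> R)) (z : 'I_n -> R) :
  semilinear A -> Fsigma [set x : 'rV[R]_n | A (fun i => x ord0 i - z i)].
Proof.
move=> [ss ->]; elim: ss => [|s ss IH].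
  by apply: closed_Fsigma; rewrite (_ : mkset _ = set0);
    [exact: closed0|apply/seteqP; split].
rewrite (_ : mkset _ =
    [set x : 'rV[R]_n | all (sat (fun i => x ord0 i - z i)) s] `|`
    [set x : 'rV[R]_n | has (all (sat (fun i => x ord0 i - z i))) ss]).
  (* The binary union is a sequence whose terms from the third on are empty. *)
  rewrite -bigcup2E; apply: Fsigma_bigcup => -[|[|k]] //=.
    elim: s => [|c s IHs].
      by apply: closed_Fsigma; rewrite (_ : mkset _ = setT);
        [exact: closedT|apply/seteqP; split].
    rewrite (_ : mkset _ =
        [set x : 'rV[R]_n | sat (fun i => x ord0 i - z i) c] `&`
        [set x : 'rV[R]_n | all (sat (fun i => x ord0 i - z i)) s]).
      by apply: FsigmaI IHs; apply: Fsigma_preimage_lteif; exact: continuous_aff.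
    by apply/seteqP; split=> x /= /andP.
  exact/closed_Fsigma/closed0.
by apply/seteqP; split=> x /= /orP.
Qed.

(** There are countably many pairs of an integer vector and an index; finite functions make this
    countability available. Each fitting pair contributes a translated semilinear set, cut to its
    cube because the description of [S] is valid only there. *)
Lemma Fsigma_slicewise_semilinear (R : realType) n (S : set ('I_n -> R)) :
  slicewise_semilinear S -> Fsigma [set x : 'rV[R]_n | S (fun i => x ord0 i)].
Proof.
move=> [I [A [sA SA]]].
pose fits (k : {ffun 'I_n -> int} * I) := forall f, unit_cube f ->
  S (fun j => (k.1 j)%:~R + f j) <-> A k.2 f.
rewrite (_ : mkset _ = \bigcup_(k in fits) [set x : 'rV[R]_n |
    (A k.2 `&` @unit_cube R n) (fun j => x ord0 j - (k.1 j)%:~R)]).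
  apply: Fsigma_bigcup => k; apply: Fsigma_semilinear; apply: semilinearI => //.
  exact: semilinear_unit_cube.
have xE (z : {ffun 'I_n -> int}) (x : 'rV[R]_n) :
    (fun j => (z j)%:~R + (x ord0 j - (z j)%:~R)) = (fun j => x ord0 j).
  by apply/funext => j; rewrite addrC subrK.
apply/seteqP; split=> [x /= Sx|x [k fk [Ax x01]]]; last first.
  by move/(fk _ x01): Ax; rewrite xE.
pose z : {ffun 'I_n -> int} := [ffun j => Num.floor (x ord0 j)].
have [i Ai] := SA z; exists (z, i) => //=.
have x01 : unit_cube (fun j => x ord0 j - (z j)%:~R).
  by move=> j; rewrite ffunE; have := floor_itv (x ord0 j); rewrite intrD; lra.
by split=> //; apply/Ai => //; rewrite xE.
Qed.

Theorem theorem1 (R : realType) (n : nat) (S : set 'rV[R]_n) :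
  (0 < n)%N -> definable S -> Fsigma S /\ Gdelta S.
Proof.
have Fsigma_holds (f : formula n) :
    Fsigma [set x : 'rV[R]_n | holds f (fun i => x ord0 i)].
  exact/Fsigma_slicewise_semilinear/slicewise_semilinear_holds.
move=> _ [f ->]; split; first exact: Fsigma_holds.
(* The complement is defined by [FNot f]; the complements of its closed pieces are the required open
   sets. *)
have [F clF fF] := Fsigma_holds (FNot f).
exists (fun k => ~` F k) => [k|]; first exact: closed_openC.
rewrite -setC_bigcup -fF; apply/seteqP; split=> x /=; last exact: contrapT.
by move=> fx nf; exact: nf fx.
Qed.
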